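(* Let $S$ be a Noetherian unique factorization domain, let $f,g$ be nonzero elements of $S$, and let $d=\gcd(f,g)$. Then $$H^2_{f,g}(S) = H^2_{f,g}(S_d) = H^2_{\frac fd,\frac gd}(S_d)$$ (canonical isomorphisms). Furthermore, the following statements are equivalent: (a) $H^2_{f,g}(S)=0$. (b) $\operatorname{ara}\big((f/d,g/d)S\big) = 1$ or $d$ is in the radical of $(f/d,g/d)S$. (c) $(fg)^n\in (f^{n+1},g^{n+1})S$ for some positive integer $n$. In particular, $H^2_{f,g}(S)\neq 0$ if and only if $\operatorname{ara}\big((f/d,g/d)S\big)=2$ and $(f/d,g/d)S_d\neq S_d$.
   Context: $S_d$ denotes the localization of $S$ at the powers of $d$. For an ideal $I$ of $S$, the arithmetic rank is $\operatorname{ara} I = \min\{\ell\in\mathbb{Z}_{\ge 0} \mid \text{there exist } z_1,\dots,z_\ell\in S \text{ with } \sqrt{(z_1,\dots,z_\ell)S}=\sqrt{I}\}$. Čech cohomology: for a ring $A$, elements $\underline{x}=x_1,\dots,x_\ell$ of $A$ and an $A$-module $M$, $H^i_{\underline{x}}(M)$ is the $i$-th cohomology of the Čech complex $0\to M\to\bigoplus_i M_{x_i}\to\bigoplus_{i<j}M_{x_ix_j}\to\cdots\to M_{x_1\cdots x_\ell}\to 0$ (with $M$ in degree $0$). In particular $H^2_{f,g}(M)$ is the cokernel of $M_f\oplus M_g\to M_{fg}$. *)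

(* Defs.v *)
From HB Require Import structures.
From mathcomp Require Import all_boot all_order all_algebra.
From mathcomp Require Import generic_quotient ring_quotient.
From mathcomp Require Import zify ring.
From mathcomp Require Import boolp classical_sets.

Set Implicit Arguments.
Unset Strict Implicit.
Unset Printing Implicit Defensive.

Import GRing.Theory.

Local Open Scope classical_set_scope.
Local Open Scope ring_scope.
Local Open Scope quotient_scope.

Section Ideals.
Variable A : comPzRingType.

Definition ideal (I : set A) : Prop :=
  [/\ I 0, forall a b, I a -> I b -> I (a + b) & forall c a, I a -> I (c * a)].

Definition ideal_gen (s : seq A) : set A :=
  [set a | exists c : 'I_(size s) -> A, a = \sum_(i < size s) c i * s`_i].

Definition radical (I : set A) : set A := [set a | exists n : nat, I (a ^+ n)].

Definition noetherian : Prop :=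
  forall I : set A, ideal I -> exists s : seq A, I = ideal_gen s.

Definition rad_generated (I : set A) (l : nat) : Prop :=
  exists z : l.-tuple A, radical (ideal_gen z) = radical I.

(* The default value 0 is returned only if no finite number of elements
   generates [I] up to radical; this never happens for the ideals of a
   Noetherian ring. *)
Definition ara (I : set A) : nat :=
  xget 0%N [set l | rad_generated I l /\
                    forall m, rad_generated I m -> (l <= m)%N].

End Ideals.

Section UFD.
Variable S : idomainType.

Definition divides (a b : S) : Prop := exists c, b = c * a.

Definition associates (a b : S) : Prop :=
  exists2 u, u \is a GRing.unit & b = u * a.

Definition irreducible_elt (p : S) : Prop :=
  [/\ p != 0, p \isn't a GRing.unit &
      forall a b, p = a * b -> a \is a GRing.unit \/ b \is a GRing.unit].

Definition ufd : Prop :=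
  (forall a : S, a != 0 -> a \isn't a GRing.unit ->
     exists2 s : seq S, (forall p, p \in s -> irreducible_elt p)
                        & a = \prod_(p <- s) p) /\
  (forall s t : seq S,
     (forall p, p \in s -> irreducible_elt p) ->
     (forall p, p \in t -> irreducible_elt p) ->
     \prod_(p <- s) p = \prod_(p <- t) p ->
     exists t' : seq S, [/\ perm_eq t' t, size s = size t' &
       forall i, (i < size s)%N -> associates s`_i t'`_i]).

Definition is_gcd (d a b : S) : Prop :=
  [/\ divides d a, divides d b &
      forall e, divides e a -> divides e b -> divides e d].

End UFD.

(* The localization M_x of an A-module M at the powers of x : A: the pair
   (m, i) stands for the fraction m / x^i. *)
Section Localization.
Variables (A : comPzRingType) (M : lmodType A) (x : A).

Definition loc_equiv (u v : M * nat) : bool :=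
  `[< exists k, x ^+ k *: (x ^+ v.2 *: u.1) = x ^+ k *: (x ^+ u.2 *: v.1) >].

Lemma loc_equiv_refl : reflexive loc_equiv.
Proof. by move=> u; apply/asboolP; exists 0%N. Qed.

Lemma loc_equiv_sym : symmetric loc_equiv.
Proof.
by move=> u v; apply/asboolP/asboolP => -[k e]; exists k; rewrite e.
Qed.

Lemma loc_equiv_trans : transitive loc_equiv.
Proof.
move=> [n j] [m i] [p l] /asboolP[k /= e] /asboolP[k' /= e'].
apply/asboolP; exists (k + k' + j)%N => /=; move: e e'.
rewrite !scalerA -!exprD => e e'.
transitivity (x ^+ (k' + l) *: (x ^+ (k + j) *: m)).
  by rewrite scalerA -exprD; congr (_ ^+ _ *: _); lia.
rewrite e scalerA -exprD.
transitivity (x ^+ (k + i) *: (x ^+ (k' + l) *: n)).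
  by rewrite scalerA -exprD; congr (_ ^+ _ *: _); lia.
by rewrite e' scalerA -exprD; congr (_ ^+ _ *: _); lia.
Qed.

Canonical loc_equiv_rel :=
  EquivRel loc_equiv loc_equiv_refl loc_equiv_sym loc_equiv_trans.

Definition loc := {eq_quot loc_equiv}.

HB.instance Definition _ : EqQuotient _ loc_equiv loc := EqQuotient.on loc.
HB.instance Definition _ := Choice.on loc.

Definition loc_frac (m : M) (i : nat) : loc := \pi_loc (m, i).

Lemma loc_fracP m i n j :
  loc_frac m i = loc_frac n j <->
  exists k, x ^+ k *: (x ^+ j *: m) = x ^+ k *: (x ^+ i *: n).
Proof.
split; first by move/eqmodP/asboolP.
by move=> e; apply/eqmodP/asboolP.
Qed.

Lemma loc_fracK (u : loc) : loc_frac (repr u).1 (repr u).2 = u.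
Proof. by rewrite /loc_frac -surjective_pairing reprK. Qed.

Lemma loc_ind (P : loc -> Prop) : (forall m i, P (loc_frac m i)) -> forall u, P u.
Proof. by move=> H u; rewrite -(loc_fracK u). Qed.

Lemma loc_repr m i : exists k,
  x ^+ k *: (x ^+ i *: (repr (loc_frac m i)).1) =
  x ^+ k *: (x ^+ (repr (loc_frac m i)).2 *: m).
Proof. exact/loc_fracP/loc_fracK. Qed.

Definition loc_add (u v : loc) : loc :=
  let: (m, i) := repr u in let: (n, j) := repr v in
  loc_frac (x ^+ j *: m + x ^+ i *: n) (i + j).
Definition loc_opp (u : loc) : loc :=
  let: (m, i) := repr u in loc_frac (- m) i.
Definition loc_scale (a : A) (u : loc) : loc :=
  let: (m, i) := repr u in loc_frac (a *: m) i.

Lemma loc_addE m i n j :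
  loc_add (loc_frac m i) (loc_frac n j) =
  loc_frac (x ^+ j *: m + x ^+ i *: n) (i + j).
Proof.
rewrite /loc_add; have [k] := loc_repr m i; have [l] := loc_repr n j.
case: (repr _) => n' j' /=; case: (repr _) => m' i' /= en em.
apply/loc_fracP; exists (k + l)%N; rewrite !scalerDr.
move: en em; rewrite !scalerA -!exprD => en em; congr (_ + _).
  transitivity (x ^+ (l + j + j') *: (x ^+ (k + i) *: m')).
    by rewrite scalerA -exprD; congr (_ ^+ _ *: _); lia.
  by rewrite em scalerA -exprD; congr (_ ^+ _ *: _); lia.
transitivity (x ^+ (k + i + i') *: (x ^+ (l + j) *: n')).
  by rewrite scalerA -exprD; congr (_ ^+ _ *: _); lia.
by rewrite en scalerA -exprD; congr (_ ^+ _ *: _); lia.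
Qed.

Lemma loc_oppE m i : loc_opp (loc_frac m i) = loc_frac (- m) i.
Proof.
rewrite /loc_opp; have [k] := loc_repr m i; case: (repr _) => m' i' /= e.
by apply/loc_fracP; exists k; rewrite !scalerN e.
Qed.

Lemma loc_scaleE a m i : loc_scale a (loc_frac m i) = loc_frac (a *: m) i.
Proof.
rewrite /loc_scale; have [k] := loc_repr m i; case: (repr _) => m' i' /= e.
apply/loc_fracP; exists k.
have aC n v : x ^+ n *: (a *: v) = a *: (x ^+ n *: v) :> M.
  by rewrite !scalerA mulrC.
by rewrite !aC e.
Qed.

Lemma loc_addA : associative loc_add.
Proof.
elim/loc_ind=> m i; elim/loc_ind=> n j; elim/loc_ind=> p l.
rewrite !loc_addE addnA; congr loc_frac.
by rewrite !scalerDr !scalerA -!exprD addrA ![(_ + i)%N]addnC ![(l + _)%N]addnC.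
Qed.

Lemma loc_addC : commutative loc_add.
Proof.
by elim/loc_ind=> m i; elim/loc_ind=> n j; rewrite !loc_addE addrC addnC.
Qed.

Lemma loc_add0 : left_id (loc_frac 0 0) loc_add.
Proof.
by elim/loc_ind=> m i; rewrite loc_addE scaler0 add0r expr0 scale1r.
Qed.

Lemma loc_addN : left_inverse (loc_frac 0 0) loc_opp loc_add.
Proof.
elim/loc_ind=> m i; rewrite loc_oppE loc_addE scalerN addNr.
by apply/loc_fracP; exists 0%N; rewrite !scaler0.
Qed.

HB.instance Definition _ :=
  GRing.isZmodule.Build loc loc_addA loc_addC loc_add0 loc_addN.

Lemma loc_scaleA a b u : loc_scale a (loc_scale b u) = loc_scale (a * b) u.
Proof. by elim/loc_ind: u => m i; rewrite !loc_scaleE scalerA. Qed.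

Lemma loc_scale1 : left_id 1 loc_scale.
Proof. by elim/loc_ind=> m i; rewrite loc_scaleE scale1r. Qed.

Lemma loc_scaleDr : right_distributive loc_scale +%R.
Proof.
move=> a; elim/loc_ind=> m i; elim/loc_ind=> n j.
rewrite [LHS](_ : _ = loc_scale a (loc_add (loc_frac m i) (loc_frac n j))) //.
rewrite [RHS](_ : _ = loc_add (loc_scale a (loc_frac m i))
                              (loc_scale a (loc_frac n j))) //.
rewrite loc_addE !loc_scaleE loc_addE scalerDr !scalerA.
by rewrite ![a * _]mulrC.
Qed.

Lemma loc_scaleDl u : {morph loc_scale^~ u : a b / a + b}.
Proof.
elim/loc_ind: u => m i a b.
rewrite [RHS](_ : _ = loc_add (loc_scale a (loc_frac m i))
                              (loc_scale b (loc_frac m i))) //.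
rewrite !loc_scaleE loc_addE -scalerDr -scalerDl.
by apply/loc_fracP; exists 0%N; rewrite exprD -!scalerA.
Qed.

HB.instance Definition _ := GRing.Zmodule_isLmodule.Build A loc
  loc_scaleA loc_scale1 loc_scaleDr loc_scaleDl.

Lemma loc_fracD m i n j : loc_frac m i + loc_frac n j =
  loc_frac (x ^+ j *: m + x ^+ i *: n) (i + j).
Proof. exact: loc_addE. Qed.

Lemma loc_fracN m i : - loc_frac m i = loc_frac (- m) i.
Proof. exact: loc_oppE. Qed.

Lemma loc_fracZ a m i : a *: loc_frac m i = loc_frac (a *: m) i.
Proof. exact: loc_scaleE. Qed.

End Localization.

Section LocalizationRing.
Variables (A : comPzRingType) (x : A).
Local Notation Ax := (loc A^o x).

Definition loc_mul (u v : Ax) : Ax :=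
  let: (a, i) := repr u in let: (b, j) := repr v in
  loc_frac x ((a : A) * b : A^o) (i + j).

Lemma loc_mulE (a b : A) i j :
  loc_mul (loc_frac x (a : A^o) i) (loc_frac x (b : A^o) j) =
  loc_frac x (a * b : A^o) (i + j).
Proof.
rewrite /loc_mul; have [k] := loc_repr x (a : A^o) i.
have [l] := loc_repr x (b : A^o) j.
case: (repr _) => b' j' /=; case: (repr _) => a' i' /= eb ea.
apply/loc_fracP; exists (k + l)%N; rewrite /GRing.scale /= in ea eb *.
rewrite !exprD.
have -> : x ^+ k * x ^+ l * (x ^+ i * x ^+ j * ((a' : A) * b')) =
  (x ^+ k * (x ^+ i * a')) * (x ^+ l * (x ^+ j * b')) by ring.
by rewrite ea eb; ring.
Qed.

Lemma loc_mulA : associative loc_mul.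
Proof.
elim/loc_ind=> a i; elim/loc_ind=> b j; elim/loc_ind=> c k.
by rewrite !loc_mulE mulrA addnA.
Qed.

Lemma loc_mulC : commutative loc_mul.
Proof.
by elim/loc_ind=> a i; elim/loc_ind=> b j; rewrite !loc_mulE mulrC addnC.
Qed.

Lemma loc_mul1 : left_id (loc_frac x (1 : A^o) 0) loc_mul.
Proof. by elim/loc_ind=> a i; rewrite loc_mulE mul1r. Qed.

Lemma loc_mulDl : left_distributive loc_mul +%R.
Proof.
elim/loc_ind=> a i; elim/loc_ind=> b j; elim/loc_ind=> c k.
rewrite loc_fracD !loc_mulE loc_fracD.
apply/loc_fracP; exists 0%N; rewrite /GRing.scale /= !exprD; ring.
Qed.

HB.instance Definition _ := GRing.Zmodule_isComPzRing.Build Ax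
  loc_mulA loc_mulC loc_mul1 loc_mulDl.

Lemma loc_fracM (a b : A) i j :
  loc_frac x (a : A^o) i * loc_frac x (b : A^o) j =
  loc_frac x (a * b : A^o) (i + j).
Proof. exact: loc_mulE. Qed.

End LocalizationRing.

Section Cokernel.
Variables (A : pzRingType) (U V : lmodType A) (f : {linear U -> V}).

Definition in_image : {pred V} := fun v => `[< exists u, f u = v >].

Lemma in_image_submod : submod_closed in_image.
Proof.
split; first by apply/asboolP; exists 0; rewrite raddf0.
move=> a v w /asboolP[u <-] /asboolP[u' <-].
by apply/asboolP; exists (a *: u + u'); rewrite linearP.
Qed.

HB.instance Definition _ :=
  GRing.isSubmodClosed.Build A V in_image in_image_submod.

Definition coker := Quotient.quot in_image.

HB.instance Definition _ := GRing.Zmodule.on coker.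

Definition coker_pi (v : V) : coker := \pi_(Quotient.quot in_image) v.

Lemma coker_piP v w : coker_pi v = coker_pi w <-> exists u, f u = v - w.
Proof.
rewrite /coker_pi; split.
  by move/eqP; rewrite -Quotient.idealrBE => /asboolP.
by move=> e; apply/eqP; rewrite -Quotient.idealrBE; apply/asboolP.
Qed.

Lemma coker_ind (P : coker -> Prop) : (forall v, P (coker_pi v)) -> forall c, P c.
Proof. by move=> H c; rewrite -[c]reprK; apply: H. Qed.

Lemma coker_piD v w : coker_pi (v + w) = coker_pi v + coker_pi w.
Proof. by rewrite /coker_pi !piE. Qed.

Definition coker_scale (a : A) (c : coker) : coker := coker_pi (a *: repr c).

Lemma coker_scaleE a v : coker_scale a (coker_pi v) = coker_pi (a *: v).
Proof.
apply/coker_piP; have /coker_piP[u e] : coker_pi (repr (coker_pi v)) = coker_pi v.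
  by rewrite /coker_pi reprK.
by exists (a *: u); rewrite linearZ /= e scalerBr.
Qed.

Lemma coker_scaleA a b c : coker_scale a (coker_scale b c) = coker_scale (a * b) c.
Proof. by elim/coker_ind: c => v; rewrite !coker_scaleE scalerA. Qed.

Lemma coker_scale1 : left_id 1 coker_scale.
Proof. by elim/coker_ind=> v; rewrite coker_scaleE scale1r. Qed.

Lemma coker_scaleDr : right_distributive coker_scale +%R.
Proof.
move=> a; elim/coker_ind=> v; elim/coker_ind=> w.
by rewrite -coker_piD !coker_scaleE -coker_piD scalerDr.
Qed.

Lemma coker_scaleDl c : {morph coker_scale^~ c : a b / a + b}.
Proof.
by elim/coker_ind: c => v a b; rewrite !coker_scaleE -coker_piD scalerDl.
Qed.

HB.instance Definition _ := GRing.Zmodule_isLmodule.Build A coker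
  coker_scaleA coker_scale1 coker_scaleDr coker_scaleDl.

Lemma coker_piZ a v : coker_pi (a *: v) = a *: coker_pi v.
Proof. by rewrite -coker_scaleE. Qed.

End Cokernel.

Section Cech.
Variables (A : comPzRingType) (M : lmodType A) (x y : A).

(* m / x^i |-> (y^i m) / (x y)^i *)
Definition cech_resl (u : loc M x) : loc M (x * y) :=
  let: (m, i) := repr u in loc_frac (x * y) (y ^+ i *: m) i.

(* m / y^i |-> (x^i m) / (x y)^i *)
Definition cech_resr (u : loc M y) : loc M (x * y) :=
  let: (m, i) := repr u in loc_frac (x * y) (x ^+ i *: m) i.

Lemma cech_reslE m i :
  cech_resl (loc_frac x m i) = loc_frac (x * y) (y ^+ i *: m) i.
Proof.
rewrite /cech_resl; have [k] := loc_repr x m i; case: (repr _) => m' i' /= e.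
apply/loc_fracP; exists k; move: e; rewrite !scalerA => e.
transitivity ((y ^+ k * y ^+ i * y ^+ i') *: ((x ^+ k * x ^+ i) *: m')).
  by rewrite scalerA !exprMn; congr (_ *: _); ring.
by rewrite e scalerA !exprMn; congr (_ *: _); ring.
Qed.

Lemma cech_resrE m i :
  cech_resr (loc_frac y m i) = loc_frac (x * y) (x ^+ i *: m) i.
Proof.
rewrite /cech_resr; have [k] := loc_repr y m i; case: (repr _) => m' i' /= e.
apply/loc_fracP; exists k; move: e; rewrite !scalerA => e.
transitivity ((x ^+ k * x ^+ i * x ^+ i') *: ((y ^+ k * y ^+ i) *: m')).
  by rewrite scalerA !exprMn; congr (_ *: _); ring.
by rewrite e scalerA !exprMn; congr (_ *: _); ring.
Qed.

Lemma cech_resl_linear : linear cech_resl.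
Proof.
move=> a; elim/loc_ind=> m i; elim/loc_ind=> n j.
rewrite loc_fracZ loc_fracD !cech_reslE loc_fracZ loc_fracD.
apply/loc_fracP; exists 0%N; rewrite !scalerDr !scalerA.
by congr (_ *: _ + _ *: _); rewrite ?exprMn ?exprD; ring.
Qed.

Lemma cech_resr_linear : linear cech_resr.
Proof.
move=> a; elim/loc_ind=> m i; elim/loc_ind=> n j.
rewrite loc_fracZ loc_fracD !cech_resrE loc_fracZ loc_fracD.
apply/loc_fracP; exists 0%N; rewrite !scalerDr !scalerA.
by congr (_ *: _ + _ *: _); rewrite ?exprMn ?exprD; ring.
Qed.

HB.instance Definition _ :=
  GRing.isLinear.Build A (loc M x) (loc M (x * y)) _ cech_resl cech_resl_linear.
HB.instance Definition _ :=
  GRing.isLinear.Build A (loc M y) (loc M (x * y)) _ cech_resr cech_resr_linear.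

(* The last nonzero differential of the Cech complex
   0 -> M -> M_x (+) M_y -> M_xy -> 0. *)
Definition cech_d1 (w : loc M x * loc M y) : loc M (x * y) :=
  cech_resr w.2 - cech_resl w.1.

Lemma cech_d1_linear : linear cech_d1.
Proof.
move=> a u v; rewrite /cech_d1 cech_resr_linear cech_resl_linear.
by rewrite opprD addrACA scalerBr.
Qed.

HB.instance Definition _ := GRing.isLinear.Build A
  (loc M x * loc M y)%type (loc M (x * y)) _ cech_d1 cech_d1_linear.

Definition H2 : lmodType A := coker cech_d1.

Definition H2_class (u : loc M (x * y)) : H2 := coker_pi cech_d1 u.

End Cech.

(* Main.v *)
Require Import Defs.
From HB Require Import structures.
From mathcomp Require Import all_boot all_order all_algebra.
From mathcomp Require Import zify ring.
From mathcomp Require Import boolp classical_sets.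
Import GRing.Theory.

Local Open Scope classical_set_scope.
Local Open Scope ring_scope.

(** Write f = f' d and g = g' d, so that f' and g' are coprime.

    Every class of H^2_{x,y}(M) is a fraction m / (x y)^n, and it vanishes
    exactly when (x y)^k m lies in x^(n+k) M + y^(n+k) M for some k
    ([H2_frac_eq0]).  Linear maps h_n on the numerators of denominator (x y)^n
    therefore induce a map on H^2 as soon as they are compatible with raising n
    and with multiples of x^n and of y^n ([H2_map_exists]).

    For the first isomorphism h_n is m |-> m/1.  As d divides f and g, a power
    of d in a denominator is cleared by multiplying numerator and denominator
    by a power of f g; this gives bijectivity ([H2_to_loc_bij]).  For the second,
    d is invertible on S_d and f g = d^2 f' g', so h_n is m |-> d^(-2n) m, with
    inverse m |-> d^(2n) m ([H2_rescale_bij]).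

    All the vanishing conditions are equivalent to: some power of d lies in
    (f', g').
    - If it does, some d^L lies in (f'^n, g'^n) as well.  Since (f g)^(n+L)
      equals d^L (f' g')^(n+L) d^(2n+L), it lies in (f^(2n+L), g^(2n+L)),
      and every class m / (f g)^n vanishes ([H2_eq0_radical]).
    - The vanishing of the class 1/(f g) is condition (c) ([H2_eq0_power]).
    - Given (c), divide by d^(n+1):
      d^(n-1) (f' g')^n = u f'^(n+1) + v g'^(n+1).  By Gauss's lemma f'^n
      divides v and g'^n divides u, so that d^(n-1) lies in (f', g')
      ([power_radical]).
    - If (f', g') has the same radical as a principal ideal (z), then z divides
      powers of the coprime elements f' and g', hence is a unit, and
      (f', g') = S ([coprime_rad_generated1]).
    Finally the arithmetic rank of (f', g') is 1 or 2 since f' is nonzero, and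
    (f', g') S_d = S_d is once more the condition on powers of d
    ([ideal_gen2_locP]). *)

(** * Classes in the second Cech cohomology as fractions *)

Section CechFractions.
Variables (A : comPzRingType) (M : lmodType A) (x y : A).

Lemma cech_d1E p i q j :
  cech_d1 (loc_frac x p i, loc_frac y q j) =
  loc_frac (x * y) (x ^+ j *: q) j - loc_frac (x * y) (y ^+ i *: p) i :> loc M _.
Proof. by rewrite /cech_d1 cech_reslE cech_resrE. Qed.

Definition H2_frac (m : M) (n : nat) : H2 M x y :=
  H2_class (loc_frac (x * y) m n).

Lemma H2_ind (P : H2 M x y -> Prop) :
  (forall m n, P (H2_frac m n)) -> forall c, P c.
Proof. by move=> H; elim/coker_ind; elim/loc_ind. Qed.

(** With i and j the exponents of the denominators of a bounding pair
    (p / x^i, q / y^j), the exponent k = l + i + j clears both, l being the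
    exponent that witnesses the equality of fractions. *)
Lemma H2_frac_eq0 m n :
  H2_frac m n = 0 <->
  exists k p q, (x * y) ^+ k *: m = x ^+ (n + k) *: p + y ^+ (n + k) *: q.
Proof.
have -> : 0 = H2_class (0 : loc M (x * y)) :> H2 M x y.
  by rewrite /H2_class -[in RHS](scale0r 0) coker_piZ scale0r.
split=> [/coker_piP[[u v]] | [k [p [q e]]]].
  elim/loc_ind: u => p i; elim/loc_ind: v => q j.
  rewrite subr0 => /(etrans (esym (cech_d1E _ _ _ _))).
  rewrite loc_fracN loc_fracD => /loc_fracP[l].
  rewrite scalerDr !scalerN scalerDr scalerN !scalerA => e.
  exists (l + i + j)%N.
  exists (y ^+ (l + n + i) *: q), (- (x ^+ (l + n + j) *: p)).
  have -> : (l + i + j = l + (j + i))%N by lia.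
  rewrite exprD -e scalerN !scalerA; congr (_ *: _ - _ *: _).
    by rewrite !exprMn !exprD; ring.
  by rewrite !exprMn !exprD; ring.
apply/coker_piP.
exists (loc_frac x (- q) (n + k), loc_frac y p (n + k)).
rewrite subr0; apply: (etrans (cech_d1E _ _ _ _)); rewrite loc_fracN loc_fracD.
apply/loc_fracP; exists 0%N; rewrite !expr0 !scale1r !scalerN opprK -!scalerDr.
rewrite -e !scalerA; congr (_ *: _).
by rewrite -!exprD; congr (_ ^+ _); lia.
Qed.

Lemma H2_fracD m i n j :
  H2_frac m i + H2_frac n j =
  H2_frac ((x * y) ^+ j *: m + (x * y) ^+ i *: n) (i + j).
Proof. by rewrite /H2_frac /H2_class -loc_fracD coker_piD. Qed.

Lemma H2_fracZ a m i : a *: H2_frac m i = H2_frac (a *: m) i.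
Proof. by rewrite /H2_frac /H2_class -loc_fracZ coker_piZ. Qed.

Lemma H2_fracB m i n j :
  H2_frac m i - H2_frac n j =
  H2_frac ((x * y) ^+ j *: m - (x * y) ^+ i *: n) (i + j).
Proof. by rewrite -scaleN1r H2_fracZ H2_fracD !scaleN1r scalerN. Qed.

Lemma H2_frac_shift k m n : H2_frac ((x * y) ^+ k *: m) (n + k) = H2_frac m n.
Proof.
congr H2_class; apply/loc_fracP; exists 0%N.
by rewrite !expr0 !scale1r scalerA exprD.
Qed.

Lemma H2_frac_repr (c : H2 M x y) :
  c = H2_frac (repr (repr c)).1 (repr (repr c)).2.
Proof. by rewrite /H2_frac loc_fracK /H2_class /coker_pi reprK. Qed.

End CechFractions.

Arguments H2_frac {A M} x y m n.
Arguments H2_ind [A M x y] P.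
Arguments H2_frac_eq0 {A M x y m n}.

(** * Maps on the second Cech cohomology *)

Section CechMap.
Variables (A : comPzRingType) (M N : lmodType A) (x y x' y' : A).
Variable h : nat -> {linear M -> N}.
Hypothesis h_step : forall n m, h n.+1 ((x * y) *: m) = (x' * y') *: h n m.
Hypothesis h_left :
  forall n m, exists p, h n (x ^+ n *: m) = x' ^+ n *: p.
Hypothesis h_right :
  forall n m, exists p, h n (y ^+ n *: m) = y' ^+ n *: p.

Let h_steps k n m : h (n + k)%N ((x * y) ^+ k *: m) = (x' * y') ^+ k *: h n m.
Proof.
elim: k => [|k IH]; first by rewrite addn0 !expr0 !scale1r.
by rewrite addnS exprS -scalerA h_step IH scalerA exprS.
Qed.

Let h_frac_eq m i n j :
  H2_frac x y m i = H2_frac x y n j ->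
  H2_frac x' y' (h i m) i = H2_frac x' y' (h j n) j.
Proof.
move/eqP; rewrite -subr_eq0 => /eqP; rewrite H2_fracB => /H2_frac_eq0[k [p [q e]]].
apply/eqP; rewrite -subr_eq0; apply/eqP; rewrite H2_fracB; apply/H2_frac_eq0.
have [p' ep] := h_left (i + j + k) p; have [q' eq] := h_right (i + j + k) q.
exists k, p', q'; rewrite -ep -eq -linearD -e !scalerBr !scalerA -!exprD linearB.
have -> : (i + j + k = i + (k + j))%N by lia.
rewrite h_steps; have -> : (i + (k + j) = j + (k + i))%N by lia.
by rewrite h_steps.
Qed.

(** The maps [h n] need not come from a single map of modules: allowing them to
    vary with the exponent n is what makes a change of the pair (x, y)
    possible. *)
Lemma H2_map_exists :
  exists phi : {linear H2 M x y -> H2 N x' y'},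
    forall m n, phi (H2_frac x y m n) = H2_frac x' y' (h n m) n.
Proof.
pose phi (c : H2 M x y) := let u := repr (repr c) in
  H2_frac x' y' (h u.2 u.1) u.2.
have phiE m n : phi (H2_frac x y m n) = H2_frac x' y' (h n m) n.
  by apply: h_frac_eq; rewrite -H2_frac_repr.
have phi_linear : linear phi.
  move=> a; elim/H2_ind=> m i; elim/H2_ind=> n j.
  rewrite H2_fracZ H2_fracD !phiE H2_fracZ H2_fracD [h _ _]linearD.
  by rewrite h_steps addnC h_steps addnC linearZ.
pose phiL := GRing.isLinear.Build A _ _ _ phi phi_linear.
by exists (HB.pack_for {linear H2 M x y -> H2 N x' y'} phi phiL).
Qed.

End CechMap.

(** * The two canonical isomorphisms *)

Lemma inj_surj_bij (U V : Type) (phi : U -> V) :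
  injective phi -> (forall v, exists u, phi u = v) -> bijective phi.
Proof.
move=> phi_inj phi_surj; pose psi v := projT1 (cid (phi_surj v)).
have psiK : cancel psi phi by move=> v; rewrite /psi; case: cid.
by exists psi => // u; apply: phi_inj.
Qed.

Section Localize.
Variables (A : comPzRingType) (M : lmodType A) (d : A).

Definition to_loc (m : M) : loc M d := loc_frac d m 0.

Lemma to_loc_linear : linear to_loc.
Proof.
move=> a m n; rewrite /to_loc loc_fracZ loc_fracD.
by rewrite expr0 !scale1r.
Qed.

HB.instance Definition _ :=
  GRing.isLinear.Build A M (loc M d) _ to_loc to_loc_linear.

(** Both injectivity and surjectivity rest on the fact that (x d) (y d) is a
    multiple of d, so that its powers absorb the powers of d created by the
    localization. *)
Lemma H2_to_loc_bij (x y : A) :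
  exists phi : {linear H2 M (x * d) (y * d) -> H2 (loc M d) (x * d) (y * d)},
    bijective phi /\
    forall m n, phi (H2_frac _ _ m n) = H2_frac _ _ (loc_frac d m 0) n.
Proof.
have [|||phi phiE] := @H2_map_exists A M (loc M d) (x * d) (y * d) (x * d) (y * d)
                       (fun _ => to_loc).
- by move=> _ m; rewrite linearZ.
- by move=> n m; exists (to_loc m); rewrite linearZ.
- by move=> n m; exists (to_loc m); rewrite linearZ.
exists phi; split=> //; apply: inj_surj_bij.
  apply: raddf_inj; elim/H2_ind=> m n; move/(etrans (esym (phiE m n))).
  move=> /H2_frac_eq0[k [P [Q]]].
  elim/loc_ind: P => p i; elim/loc_ind: Q => q j.
  rewrite !loc_fracZ loc_fracD => /loc_fracP[l e].
  (* In ((x d) (y d))^L = (x y)^L d^L d^L, one factor d^L clears both denominators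
     and the power d^l that witnesses the equality of fractions. *)
  pose L := (l + i + j)%N; apply/H2_frac_eq0; exists (k + L)%N.
  exists ((y ^+ L * d ^+ (l + j)) *: p), ((x ^+ L * d ^+ (l + i)) *: q).
  transitivity ((x * y * d) ^+ L *:
    (d ^+ l *: (d ^+ (i + j) *: ((x * d * (y * d)) ^+ k *: m)))).
    by rewrite !scalerA; congr (_ *: _); rewrite /L !exprMn !exprD ?exprMn; ring.
  rewrite e expr0 scale1r !scalerDr !scalerA.
  by congr (_ *: _ + _ *: _); rewrite /L !exprMn !exprD ?exprMn; ring.
elim/H2_ind=> u n; elim/loc_ind: u => m i.
(* m / d^i = (d x y)^i m / ((x d) (y d))^i *)
exists (H2_frac _ _ ((d * x * y) ^+ i *: m) (n + i)).
rewrite phiE -(H2_frac_shift _ _ _ _ i (loc_frac d m i) n) loc_fracZ.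
congr H2_frac; apply/loc_fracP; exists 0%N.
by rewrite !expr0 !scale1r !scalerA; congr (_ *: _); rewrite !exprMn; ring.
Qed.

End Localize.

Section Rescale.
Variables (A : comPzRingType) (d : A).
Local Notation Ad := (loc A^o d).

Definition inv_pow (n : nat) (m : Ad) : Ad := loc_frac d (1 : A^o) n * m.

Lemma inv_powE n (a : A) i :
  inv_pow n (loc_frac d (a : A^o) i) = loc_frac d (a : A^o) (n + i).
Proof. by rewrite /inv_pow loc_fracM mul1r. Qed.

Lemma inv_pow_linear n : linear (inv_pow n).
Proof.
move=> a u v; rewrite /inv_pow mulrDr; congr (_ + _).
elim/loc_ind: u => m i; rewrite loc_fracZ !loc_fracM loc_fracZ.
by rewrite !mul1r.
Qed.

HB.instance Definition _ n :=
  GRing.isLinear.Build A Ad Ad _ (inv_pow n) (inv_pow_linear n).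

Lemma inv_powK n m : d ^+ n *: inv_pow n m = m.
Proof.
elim/loc_ind: m => a i; rewrite inv_powE loc_fracZ.
by apply/loc_fracP; exists 0%N; rewrite !scalerA !exprD !expr0 !mul1r mulrC.
Qed.

Lemma inv_pow_scale k n m : inv_pow (n + k) (d ^+ k *: m) = inv_pow n m.
Proof.
elim/loc_ind: m => a i; rewrite loc_fracZ !inv_powE.
apply/loc_fracP; exists 0%N; rewrite !scalerA; congr (_ *: _).
by rewrite !exprD; ring.
Qed.

(** The factor d^(-2n) turns the denominator ((x d) (y d))^n into (x y)^n.  It
    also respects boundaries: a multiple of (x d)^n becomes d^(-n) times a
    multiple of x^n. *)
Lemma H2_rescale_bij (x y : A) :
  exists psi : {linear H2 Ad (x * d) (y * d) -> H2 Ad x y},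
    bijective psi /\
    forall m n, psi (H2_frac _ _ m n) = H2_frac _ _ (inv_pow (2 * n) m) n.
Proof.
have [|||psi psiE] := @H2_map_exists A Ad Ad (x * d) (y * d) x y
                       (fun n => inv_pow (2 * n)).
- move=> n m.
  have -> : x * d * (y * d) = x * y * d ^+ 2 by ring.
  by rewrite -scalerA linearZ /= mulnS addnC inv_pow_scale.
- move=> n m; exists (inv_pow n m).
  by rewrite exprMn -scalerA linearZ /= mul2n -addnn inv_pow_scale.
- move=> n m; exists (inv_pow n m).
  by rewrite exprMn -scalerA linearZ /= mul2n -addnn inv_pow_scale.
exists psi; split=> //.
have [|||chi chiE] := @H2_map_exists A Ad Ad x y (x * d) (y * d)
                       (fun n => *:%R (d ^+ (2 * n))).
- by move=> n m /=; rewrite !scalerA; congr (_ *: _); rewrite mulnS exprD; ring.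
- move=> n m /=; exists (d ^+ n *: m).
  by rewrite !scalerA; congr (_ *: _); rewrite mul2n -addnn exprD exprMn; ring.
- move=> n m /=; exists (d ^+ n *: m).
  by rewrite !scalerA; congr (_ *: _); rewrite mul2n -addnn exprD exprMn; ring.
exists chi; elim/H2_ind=> m n.
  apply: (etrans (congr1 chi (psiE m n))); apply: (etrans (chiE _ _)).
  congr (H2_frac _ _ _ n); exact: inv_powK.
apply: (etrans (congr1 psi (chiE m n))); apply: (etrans (psiE _ _)).
congr (H2_frac _ _ _ n); apply: (etrans (linearZ_LR _ _ _)); exact: inv_powK.
Qed.

End Rescale.
(** * Ideals with two generators *)

Section TwoGenerated.
Variable A : comPzRingType.
Implicit Types a b c e : A.

Lemma ideal_gen2P a b c :
  ideal_gen [:: a; b] c <-> exists u v, c = u * a + v * b.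
Proof.
split=> [[w ->] | [u [v ->]]].
  by exists (w ord0), (w (lift ord0 ord0)); rewrite !big_ord_recl big_ord0 addr0.
exists (fun i => if i == ord0 then u else v).
by rewrite !big_ord_recl big_ord0 addr0.
Qed.

(** By induction on n: the product of u a^n + v b and p a + q b lies in
    (a^(n+1), b). *)
Lemma radical_gen2X a b e n :
  radical (ideal_gen [:: a; b]) e -> radical (ideal_gen [:: a ^+ n; b]) e.
Proof.
move=> [N /ideal_gen2P[p [q eN]]].
elim: n => [|n [L /ideal_gen2P[u [v eL]]]].
  by exists 0%N; apply/ideal_gen2P; exists 1, 0; rewrite !expr0; ring.
exists (L + N)%N; apply/ideal_gen2P; exists (u * p), (v * e ^+ N + u * a ^+ n * q).
rewrite exprD eL mulrDl {1}eN exprS; ring.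
Qed.

Lemma ideal_gen2C a b : ideal_gen [:: a; b] = ideal_gen [:: b; a].
Proof.
by apply/seteqP; split=> c /ideal_gen2P[u [v ->]]; apply/ideal_gen2P;
  exists v, u; rewrite addrC.
Qed.

Lemma radical_gen2XX a b e n :
  radical (ideal_gen [:: a; b]) e -> radical (ideal_gen [:: a ^+ n; b ^+ n]) e.
Proof.
by move/(radical_gen2X _ _ _ n); rewrite ideal_gen2C => /(radical_gen2X _ _ _ n);
  rewrite ideal_gen2C.
Qed.

End TwoGenerated.

Section TwoGeneratedLoc.
Variable A : comPzRingType.
Implicit Types a b e : A.

(** Clearing denominators in an expression of 1 shows that a power of e already
    lies in (a, b). *)
Lemma ideal_gen2_locP a b e :
  ideal_gen [:: loc_frac e (a : A^o) 0; loc_frac e (b : A^o) 0] = setT <->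
  radical (ideal_gen [:: a; b]) e.
Proof.
split=> [IT | [N /ideal_gen2P[u [v eN]]]].
  have [U [V]] : exists U V : loc A^o e,
    1 = U * loc_frac e (a : A^o) 0 + V * loc_frac e (b : A^o) 0.
    by apply/ideal_gen2P; rewrite IT.
  elim/loc_ind: U => u i; elim/loc_ind: V => v j.
  rewrite !loc_fracM loc_fracD => /loc_fracP[k].
  rewrite /GRing.scale /= !addn0 expr0 !mulr1 mul1r => E.
  exists (k + (i + j))%N; apply/ideal_gen2P.
  exists (e ^+ k * e ^+ j * u), (e ^+ k * e ^+ i * v).
  by rewrite exprD E; ring.
apply/seteqP; split=> // w _; apply/ideal_gen2P.
exists (w * loc_frac e (u : A^o) N), (w * loc_frac e (v : A^o) N).
rewrite -!mulrA -mulrDr -[LHS]mulr1; congr (_ * _).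
rewrite !loc_fracM loc_fracD; apply/loc_fracP; exists 0%N.
rewrite /GRing.scale /= !addn0 !expr0 !mul1r !exprD !mulr1.
by rewrite -mulrDr -eN.
Qed.

End TwoGeneratedLoc.

(** * Coprimality in a factorial domain *)

Section Factorial.
Variables (S : idomainType) (hU : ufd S).
Implicit Types a b c p z : S.

(** Stated through irreducible factors, coprimality passes at once to powers;
    for nonzero elements of a factorial domain it is the absence of common
    nonunit divisors. *)
Definition irr_coprime a b : Prop :=
  forall p, irreducible_elt p -> divides p a -> ~ divides p b.

Lemma divides_trans a b c : divides a b -> divides b c -> divides a c.
Proof. by move=> [u ->] [v ->]; exists (v * u); rewrite mulrA. Qed.

Lemma factor_unit a : a != 0 -> exists u (s : seq S),
  [/\ u \is a GRing.unit, forall p, p \in s -> irreducible_elt p &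
      a = u * \prod_(p <- s) p].
Proof.
move=> a0; case: (boolP (a \is a GRing.unit)) => [ua | nua].
  by exists a, [::]; rewrite big_nil mulr1.
have [s irr_s ->] := hU.1 a a0 nua.
by exists 1, s; rewrite mul1r unitr1.
Qed.

Lemma irreducible_unitM u p :
  u \is a GRing.unit -> irreducible_elt p -> irreducible_elt (u * p).
Proof.
move=> uu [p0 nup irr_p]; split.
- by rewrite mulf_neq0 //; apply: contraTneq uu => ->; rewrite unitr0.
- by rewrite unitrMr.
move=> a b e; have [|ua|] := irr_p (u^-1 * a) b; last by right.
  by rewrite -mulrA -e mulKr.
by left; rewrite unitrMr ?unitrV in ua.
Qed.

Lemma divides_prod p (s : seq S) : p \in s -> divides p (\prod_(q <- s) q).
Proof. by move=> ps; rewrite (big_rem p) //= mulrC; eexists. Qed.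

(** Factoring both sides of a b = c p gives two factorizations of the same
    element; uniqueness matches p with a factor of a or of b. *)
Lemma irreducible_prime p a b :
  irreducible_elt p -> divides p (a * b) -> divides p a \/ divides p b.
Proof.
move=> irr_p [c abE].
have [->|a0] := eqVneq a 0; first by left; exists 0; rewrite mul0r.
have [->|b0] := eqVneq b 0; first by right; exists 0; rewrite mul0r.
have c0 : c != 0.
  by apply: contra_eq_neq abE => ->; rewrite mul0r mulf_neq0.
have [u [s [uu irr_s aE]]] := factor_unit _ a0.
have [v [t [uv irr_t bE]]] := factor_unit _ b0.
have [w [r [uw irr_r cE]]] := factor_unit _ c0.
have uuv : u * v \is a GRing.unit by rewrite unitrMl.
(* Uniqueness compares products without unit factors, so the units of a, b and c
   are absorbed into p. *)
set k := (u * v)^-1 * w.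
have uk : k \is a GRing.unit by rewrite unitrMl // unitrV.
have [|||l [l_perm _ l_assoc]] := hU.2 (k * p :: r) (s ++ t) _ _ _.
- by move=> q; rewrite inE => /predU1P[->|/irr_r //]; apply: irreducible_unitM.
- by move=> q; rewrite mem_cat => /orP[/irr_s|/irr_t].
- rewrite big_cons big_cat /=; apply: (mulrI uuv).
  transitivity (c * p); last by rewrite -abE aE bE; ring.
  rewrite cE; transitivity (u * v * (u * v)^-1 * (w * \prod_(j <- r) j * p)).
    by rewrite /k; ring.
  by rewrite mulrV // mul1r.
have [y uy] := l_assoc 0%N isT; rewrite /= => kpE.
have l0 : l`_0 \in s ++ t.
  have [small|big] := ltnP 0 (size l); first by rewrite -(perm_mem l_perm) mem_nth.
  move: kpE; rewrite nth_default // => /esym/eqP; have [p0 _ _] := irr_p.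
  rewrite mulrA mulf_eq0 (negPf p0) orbF => /eqP yk0.
  by have := unitrMr k uy; rewrite yk0 uk unitr0.
have p_l0 : divides p l`_0 by exists (y * k); rewrite kpE mulrA.
move: l0; rewrite mem_cat => /orP[] /divides_prod l0; [left|right].
  by apply: divides_trans p_l0 (divides_trans _ _ _ l0 _); rewrite aE; eexists.
by apply: divides_trans p_l0 (divides_trans _ _ _ l0 _); rewrite bE; eexists.
Qed.

Lemma irreducible_divX p a n :
  irreducible_elt p -> divides p (a ^+ n) -> divides p a.
Proof.
move=> irr_p; elim: n => [[c /esym cE]|n IH].
  have [_ nup _] := irr_p.
  by case/negP: nup; apply/unitrP; exists c; rewrite [p * c]mulrC cE.
by rewrite exprS => /(irreducible_prime _ _ _ irr_p)[].
Qed.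

Lemma irr_coprimeX a b m n : irr_coprime a b -> irr_coprime (a ^+ m) (b ^+ n).
Proof.
move=> ab p irr_p /(irreducible_divX _ _ _ irr_p) pa.
by move=> /(irreducible_divX _ _ _ irr_p); apply: ab.
Qed.

Lemma irr_coprime_sym a b : irr_coprime a b -> irr_coprime b a.
Proof. by move=> ab p irr_p pb pa; apply: (ab p). Qed.

(** Gauss's lemma: the irreducible factors of a are removed one by one, each
    being prime and not dividing b. *)
Lemma gauss_divides a b c :
  a != 0 -> irr_coprime a b -> divides a (b * c) -> divides a c.
Proof.
move=> /factor_unit[u [s [uu irr_s ->]]] ab.
suff div_s : divides (\prod_(p <- s) p) (b * c) -> divides (\prod_(p <- s) p) c.
  move=> [k e]; have [|k' ->] := div_s; first by exists (k * u); rewrite -mulrA.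
  by exists (k' * u^-1); rewrite mulrA mulrVK.
have {}ab p : p \in s -> ~ divides p b.
  move=> ps; apply: ab; first exact: irr_s.
  by apply: divides_trans (divides_prod _ _ ps) _; eexists.
elim: s c irr_s ab => [|p s IH] c irr_s ab.
  by exists c; rewrite big_nil mulr1.
rewrite big_cons => -[k bcE].
have irr_p : irreducible_elt p by apply: irr_s; rewrite inE eqxx.
have [|/ab []|[c' cE]] := irreducible_prime p b c irr_p.
- by exists (k * \prod_(j <- s) j); rewrite bcE; ring.
- by rewrite inE eqxx.
have [p0 _ _] := irr_p.
have [|||l c'E] := IH c' _ _ _.
- by move=> q qs; apply: irr_s; rewrite inE qs orbT.
- by move=> q qs; apply: ab; rewrite inE qs orbT.
- by exists k; apply: (mulfI p0); move: bcE; rewrite cE => e; ring: e.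
by exists l; rewrite cE c'E; ring.
Qed.

Lemma common_divisor_unit z a b :
  z != 0 -> irr_coprime a b -> divides z a -> divides z b -> z \is a GRing.unit.
Proof.
move=> /factor_unit[u [[|p s] [uu irr_s ->]]] ab za zb.
  by rewrite big_nil mulr1.
have irr_p : irreducible_elt p by apply: irr_s; rewrite inE eqxx.
have pz : divides p (u * \prod_(q <- p :: s) q).
  by exists (u * \prod_(q <- s) q); rewrite big_cons; ring.
by case: (ab p irr_p); apply: divides_trans pz _.
Qed.

(** A common factor p of a and b would make p d a common divisor of a d and b d,
    hence a divisor of d. *)
Lemma cofactors_coprime d a b :
  d != 0 -> is_gcd d (a * d) (b * d) -> irr_coprime a b.
Proof.
move=> d0 [_ _ gcdP] p [p0 nup irr_p] [x aE] [y bE].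
have [||k /esym dE] := gcdP (p * d).
- by exists x; rewrite aE mulrA.
- by exists y; rewrite bE mulrA.
case/negP: nup; apply/unitrP; exists k; rewrite [p * k]mulrC.
by have kp1 : k * p = 1 by apply: (mulIf d0); rewrite mul1r -mulrA.
Qed.

Lemma radical_principal_coprime a b z :
  a != 0 -> irr_coprime a b ->
  radical (ideal_gen [:: z]) a -> radical (ideal_gen [:: z]) b ->
  z \is a GRing.unit.
Proof.
move=> a0 ab [m [c]]; rewrite big_ord_recl big_ord0 addr0 => aE.
move=> [n [k]]; rewrite big_ord_recl big_ord0 addr0 => bE.
apply: (common_divisor_unit z (a ^+ m) (b ^+ n)).
- by apply: contraNneq a0 => z0; move: aE; rewrite /= z0 mulr0 => /eqP;
    rewrite expf_eq0 => /andP[_ /eqP ->].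
- exact: irr_coprimeX.
- by eexists; apply: aE.
- by eexists; apply: bE.
Qed.

Lemma gen2_sub_radical a b :
  radical (ideal_gen [:: a; b]) a /\ radical (ideal_gen [:: a; b]) b.
Proof.
split; exists 1%N; apply/ideal_gen2P.
  by exists 1, 0; rewrite expr1; ring.
by exists 0, 1; rewrite expr1; ring.
Qed.

(** Coprime elements are never, up to radical, generated by one nonunit: that
    element would divide powers of both. *)
Lemma coprime_rad_generated1 a b :
  a != 0 -> irr_coprime a b ->
  rad_generated (ideal_gen [:: a; b]) 1 -> radical (ideal_gen [:: a; b]) 1.
Proof.
move=> a0 ab [z zE]; have [ra rb] := gen2_sub_radical a b.
move: ra rb; rewrite -zE; case/tupleP: z {zE} => z t; rewrite tuple0 /= => ra rb.
have uz := radical_principal_coprime _ _ _ a0 ab ra rb.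
exists 1%N; exists (fun=> z^-1).
by rewrite big_ord_recl big_ord0 /= addr0 mulVr ?expr1.
Qed.

Lemma ara_gen2 a b : a != 0 ->
  rad_generated (ideal_gen [:: a; b]) (ara (ideal_gen [:: a; b])) /\
  ara (ideal_gen [:: a; b]) \in [:: 1%N; 2%N].
Proof.
move=> a0; set I := ideal_gen _.
have gen2 : rad_generated I 2 by exists [tuple a; b].
have gen0 : ~ rad_generated I 0.
  move=> [z zE]; have [ra _] := gen2_sub_radical a b.
  move: ra; rewrite -/I -zE tuple0 => -[n [c]]; rewrite big_ord0 => /eqP.
  by rewrite expf_eq0 (negPf a0) andbF.
have : exists l, rad_generated I l /\ forall m, rad_generated I m -> (l <= m)%N.
  have [gen1|ngen1] := pselect (rad_generated I 1).
    by exists 1%N; split=> // -[/gen0|].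
  by exists 2%N; split=> // -[/gen0|[/ngen1|]].
move/(xgetPex 0%N); rewrite -/(ara I) => -[gen /(_ _ gen2) le2].
split=> //; move: gen le2.
by case: (ara I) => [/gen0|[|[]]].
Qed.

End Factorial.

Arguments irr_coprime {S}.
Arguments irr_coprimeX {S} hU {a b}.
Arguments irr_coprime_sym {S a b}.
Arguments gauss_divides {S} hU {a} b {c}.
Arguments cofactors_coprime {S d a b}.
Arguments coprime_rad_generated1 {S} hU {a b}.
Arguments ara_gen2 {S a} b.

(** * Vanishing of the second Cech cohomology *)

Section Vanishing.
Variable A : comPzRingType.

(** If d^L = u x^n + v y^n, multiplying by (x y)^(n+L) gives a combination of
    x^(2n+L) and y^(2n+L), the powers that kill a class of exponent n. *)
Lemma H2_eq0_radical (M : lmodType A) (x y d : A) :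
  radical (ideal_gen [:: x; y]) d -> forall h : H2 M (x * d) (y * d), h = 0.
Proof.
move=> rad_d; elim/H2_ind=> m n; apply/H2_frac_eq0.
have [L /ideal_gen2P[u [v dL]]] := radical_gen2XX _ _ _ _ n rad_d.
exists (n + L)%N, ((y ^+ (n + L) * u) *: m), ((x ^+ (n + L) * v) *: m).
rewrite !scalerA -scalerDl; congr (_ *: _).
transitivity ((x * y) ^+ (n + L) * d ^+ (n + (n + L)) * d ^+ L).
  by rewrite !exprMn !exprD; ring.
by rewrite dL !exprMn !exprD; ring.
Qed.

(** The criterion for the class 1 / (x y), whose exponent k may be 0, is
    multiplied once more by x y to make the exponent positive. *)
Lemma H2_eq0_power (x y : A) :
  (forall h : H2 A^o x y, h = 0) ->
  exists n, (0 < n)%N /\ ideal_gen [:: x ^+ n.+1; y ^+ n.+1] ((x * y) ^+ n).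
Proof.
move=> /(_ (H2_frac x y (1 : A^o) 1)) /H2_frac_eq0[k [p [q]]].
rewrite /GRing.scale /= mulr1 !add1n => e.
exists k.+1; split=> //; apply/ideal_gen2P; exists ((p : A) * y), ((q : A) * x).
by rewrite exprS e !exprS; ring.
Qed.

End Vanishing.

(** After division by d^(n+2), Gauss's lemma forces the coefficient of y^(n+2)
    to be a multiple of x^(n+1) and that of x^(n+2) to be a multiple of y^(n+1);
    cancelling (x y)^(n+1) leaves d^n in (x, y). *)
Lemma power_radical (S : idomainType) (hU : ufd S) (x y d : S) n :
  x != 0 -> y != 0 -> d != 0 -> irr_coprime x y ->
  ideal_gen [:: (x * d) ^+ n.+2; (y * d) ^+ n.+2] ((x * d * (y * d)) ^+ n.+1) ->
  radical (ideal_gen [:: x; y]) d.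
Proof.
move=> x0 y0 d0 xy /ideal_gen2P[u [v e]].
have e1 : d ^+ n * x ^+ n.+1 * y ^+ n.+1 = u * x ^+ n.+2 + v * y ^+ n.+2.
  apply: (mulfI (expf_neq0 n.+2 d0)).
  transitivity ((x * d * (y * d)) ^+ n.+1); first by rewrite !exprMn !exprS; ring.
  by rewrite e !exprMn; ring.
have [w vE] : divides (x ^+ n.+1) v.
  apply: (gauss_divides hU (y ^+ n.+2)); first exact: expf_neq0.
    exact: irr_coprimeX.
  exists (d ^+ n * y ^+ n.+1 - u * x).
  transitivity (d ^+ n * x ^+ n.+1 * y ^+ n.+1 - u * x ^+ n.+2).
    by rewrite e1; ring.
  by rewrite [x ^+ n.+2]exprS; ring.
have e2 : d ^+ n * y ^+ n.+1 = u * x + w * y ^+ n.+2.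
  apply: (mulfI (expf_neq0 n.+1 x0)).
  transitivity (u * x ^+ n.+2 + v * y ^+ n.+2); first by rewrite -e1; ring.
  by rewrite vE [x ^+ n.+2]exprSr; ring.
have [t uE] : divides (y ^+ n.+1) u.
  apply: (gauss_divides hU x); first exact: expf_neq0.
    by have := irr_coprimeX hU n.+1 1 (irr_coprime_sym xy); rewrite expr1.
  exists (d ^+ n - w * y).
  transitivity (d ^+ n * y ^+ n.+1 - w * y ^+ n.+2); first by rewrite e2; ring.
  by rewrite [y ^+ n.+2]exprS; ring.
exists n; apply/ideal_gen2P; exists t, w.
apply: (mulfI (expf_neq0 n.+1 y0)).
by rewrite mulrC e2 uE [y ^+ n.+2]exprS; ring.
Qed.

Theorem lemma16 (S : idomainType) (hN : noetherian S) (hU : ufd S)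
    (f g : S) (hf : f != 0) (hg : g != 0)
    (d : S) (hd : is_gcd d f g)
    (* f' and g' are the quotients f/d and g/d *)
    (f' g' : S) (hf' : f = f' * d) (hg' : g = g' * d) :
  [/\ (* H^2_{f,g}(S) = H^2_{f,g}(S_d), induced by S -> S_d *)
      exists phi : {linear H2 S^o f g -> H2 (loc S^o d) f g},
        bijective phi /\
        forall (a : S^o) (n : nat),
          phi (H2_class (loc_frac (f * g) a n)) =
          H2_class (loc_frac (f * g) (loc_frac d a 0) n),
      (* H^2_{f,g}(S_d) = H^2_{f/d,g/d}(S_d), since
         m / (f g)^n = (d^(-2n) m) / (f/d * g/d)^n for m in S_d *)
      exists psi : {linear H2 (loc S^o d) f g -> H2 (loc S^o d) f' g'},
        bijective psi /\
        forall (m : loc S^o d) (n : nat),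
          psi (H2_class (loc_frac (f * g) m n)) =
          H2_class (loc_frac (f' * g')
                      (loc_frac d (1 : S^o) (2 * n)%N * m) n),
      [<-> (forall h : H2 S^o f g, h = 0);
           ara (ideal_gen [:: f'; g']) = 1%N \/
             radical (ideal_gen [:: f'; g']) d;
           exists n : nat, (0 < n)%N /\
             ideal_gen [:: f ^+ n.+1; g ^+ n.+1] ((f * g) ^+ n)]
    & (~ (forall h : H2 S^o f g, h = 0) <->
       ara (ideal_gen [:: f'; g']) = 2%N /\
       ideal_gen [:: loc_frac d (f' : S^o) 0; loc_frac d (g' : S^o) 0]
         <> [set: loc S^o d])].

Proof.
have d0 : d != 0 by apply: contraNneq hf; rewrite hf' => ->; rewrite mulr0.
have f'0 : f' != 0 by apply: contraNneq hf; rewrite hf' => ->; rewrite mul0r.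
have g'0 : g' != 0 by apply: contraNneq hg; rewrite hg' => ->; rewrite mul0r.
rewrite {f}hf' {g}hg' in hf hg hd *.
have cop := cofactors_coprime d0 hd.
have [gen_ara ara12] := ara_gen2 g' f'0.
have ara1_rad : ara (ideal_gen [:: f'; g']) = 1%N ->
    radical (ideal_gen [:: f'; g']) d.
  move=> ara1; rewrite ara1 in gen_ara.
  have [n] := coprime_rad_generated1 hU f'0 cop gen_ara.
  rewrite expr1n => /ideal_gen2P[u [v e]].
  by exists 0%N; apply/ideal_gen2P; exists u, v.
have rad_H2 := H2_eq0_radical S S^o f' g' d.
have H2_rad : (forall h : H2 S^o (f' * d) (g' * d), h = 0) ->
    radical (ideal_gen [:: f'; g']) d.
  by move=> /H2_eq0_power[[|n] [// _]]; apply: power_radical.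
split.
- exact: H2_to_loc_bij.
- exact: H2_rescale_bij.
- tfae.
  + by move=> /H2_rad; right.
  + by move=> rad_d; apply/H2_eq0_power/rad_H2; case: rad_d.
  + by move=> [[|n] [// _ e]]; apply/rad_H2; apply: power_radical e.
split=> [nH2 | [ara2 nT] H2_0].
  split; last by move/ideal_gen2_locP/rad_H2.
  move: ara12; rewrite !inE => /orP[/eqP ara1|/eqP //].
  by case: nH2; apply/rad_H2/ara1_rad.
by apply/nT/ideal_gen2_locP/H2_rad.
Qed.
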